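(* Let $\kappa$ be a constant and $q_1,q_2,t_1,t_2,v$ indeterminates. Let $V_0(q_1,q_2,t_1,t_2)$ be the coefficient of $z^0$ in $$V(z;q_1,t_1,q_2,t_2)=\exp\Big(\sum_{k\ge1}(q_1^k-q_2^k)\mathfrak a_{-k}\frac{z^k}{k}\Big)\exp\Big(\sum_{k\ge1}(t_2^k-t_1^k)\mathfrak a_k\frac{z^{-k}}{k}\Big).$$ Then $$\big\langle V_0(q_1,q_2,t_1,t_2)\big\rangle_v=\left[\frac{(q_1t_1v)_\infty\,(q_2t_2v)_\infty}{(q_1t_2v)_\infty\,(q_2t_1v)_\infty}\right]^{\kappa}.$$
   Context: The Heisenberg algebra is generated by a central element $\mathrm I$ and $\mathfrak a_n$, $n\in\mathbb Z$, with $[\mathfrak a_m,\mathfrak a_n]=\kappa m\delta_{m,-n}\mathrm I$. The Fock space $B$ is the irreducible representation generated by a vector $|0\rangle$ with $\mathrm I|0\rangle=|0\rangle$, $\mathfrak a_n|0\rangle=0$ for $n\ge0$; it has basis $\mathfrak a_{-\lambda}=\mathfrak a_{-\lambda_1}\mathfrak a_{-\lambda_2}\cdots|0\rangle$ over partitions $\lambda$. The energy operator $L_0$ acts on $\mathfrak a_{-\lambda}$ by multiplication by $|\lambda|$. For an operator $\Delta$ on $B$ preserving degree, $\langle \Delta\rangle_v:=(v)_\infty\,\mathrm{Tr}_B(v^{L_0}\Delta)$, a formal power series in $v$. Notation: $(a)_\infty=\prod_{i\ge0}(1-av^i)$, and $[\,\cdot\,]^\kappa$ is $\exp(\kappa\log(\cdot))$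 with the logarithm expanded as a formal power series. *)

(* Defs.v *)
From HB Require Import structures.
From mathcomp Require Import all_boot all_order all_algebra.
From mathcomp Require Import mpoly.
Set Implicit Arguments. Unset Strict Implicit. Unset Printing Implicit Defensive.
Import Order.TTheory GRing.Theory.
Local Open Scope ring_scope.

Section PowerSeries.
Variable R : fieldType.

Definition pser := nat -> R.

Definition ps_trunc (f : pser) (n : nat) : {poly R} := \poly_(i < n.+1) f i.

Definition ps_mul (f g : pser) : pser :=
  fun n => \sum_(i < n.+1) f i * g (n - i)%N.

Definition ps_scale (c : R) (f : pser) : pser := fun n => c * f n.

(* exp(h) = sum_{m>=0} h^m/m!  (for h with zero constant term, so only
   m <= n contributes to the coefficient of v^n) *)
Definition ps_exp (h : pser) : pser :=
  fun n => (\sum_(m < n.+1) (m`!%:R)^-1 *: (ps_trunc h n) ^+ m)`_n.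

(* log(f) = sum_{m>=1} (-1)^(m+1) (f-1)^m / m  (for f with constant term 1) *)
Definition ps_log (f : pser) : pser :=
  fun n => (\sum_(m < n) ((-1) ^+ m / (m.+1)%:R) *: (ps_trunc f n - 1) ^+ m.+1)`_n.

(* 1/f = sum_{m>=0} (1-f)^m  (for f with constant term 1) *)
Definition ps_inv (f : pser) : pser :=
  fun n => (\sum_(m < n.+1) (1 - ps_trunc f n) ^+ m)`_n.

Definition ps_powk (f : pser) (kappa : R) : pser := ps_exp (ps_scale kappa (ps_log f)).

(* (c v)_oo = prod_{i>=0} (1 - c v^(i+1)) ; in particular (v)_oo = qpoch 1 *)
Definition qpoch (c : R) : pser :=
  fun n => (\prod_(i < n) (1 - c *: 'X^(i.+1)))`_n.

End PowerSeries.

(* B is realised as polynomials in x_1, x_2, ... with a_{-k} = mult.  *)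
(* by x_k and a_k = kappa k d/dx_k (k >= 1), |0> = 1, so that         *)
(* a_{-lambda}|0> = x^lambda.  The degree-n part B_n only involves    *)
(* x_1..x_n, so we work in {mpoly R[N]} with variable i <-> x_(i+1).   *)
Section Fock.
Variables (R : fieldType) (N : nat) (kappa : R).

Definition op := {mpoly R[N]} -> {mpoly R[N]}.

(* creation operator a_{-k}, k >= 1 (only k <= N is ever used) *)
Definition acre (k : nat) : op :=
  fun p => match insub k.-1 with Some i => 'X_i * p | None => 0 end.

Definition aann (k : nat) : op :=
  fun p => match insub k.-1 with
           | Some i => (kappa * k%:R) *: mderiv i p | None => 0 end.

Definition opser := nat -> op.

Definition opser_one : opser := fun i p => if i == 0%N then p else 0.

Definition opser_mul (S T : opser) : opser :=
  fun i p => \sum_(k < i.+1) S k (T (i - k)%N p).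

Definition opser_pow (S : opser) (m : nat) : opser := iter m (opser_mul S) opser_one.

(* exp(S) for S with no constant term *)
Definition opser_exp (S : opser) : opser :=
  fun i p => \sum_(m < i.+1) (m`!%:R)^-1 *: opser_pow S m i p.

Definition cre_series (c : nat -> R) : opser :=
  fun k p => if k == 0%N then 0 else ((c k) / k%:R) *: acre k p.
Definition ann_series (d : nat -> R) : opser :=
  fun k p => if k == 0%N then 0 else ((d k) / k%:R) *: aann k p.

(* V(z) = (sum_i A_i z^i)(sum_j B_j z^-j), so the z^0 coefficient is
   V_0 = sum_{j>=0} A_j B_j; on B_n the terms j > n vanish. *)
Definition V0_on_deg (q1 q2 t1 t2 : R) (n : nat) : op :=
  fun p => \sum_(j < n.+1)
     opser_exp (cre_series (fun k => q1 ^+ k - q2 ^+ k)) j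
       (opser_exp (ann_series (fun k => t2 ^+ k - t1 ^+ k)) j p).

(* weighted degree (energy L_0) of the monomial x^m : sum_i (i+1) m_i *)
Definition energy (m : 'X_{1..N}) : nat := (\sum_(i < N) i.+1 * m i)%N.

End Fock.

(* Tr_{B_n}(V_0): sum over the basis a_{-lambda}, |lambda| = n, i.e. the
   monomials x^m of energy n (these have total degree <= n). *)
Definition trace_V0_deg (R : fieldType) (kappa q1 q2 t1 t2 : R) (n : nat) : R :=
  \sum_(m : 'X_{1..n < n.+1} | energy m == n)
     (V0_on_deg kappa q1 q2 t1 t2 n 'X_[m : 'X_{1..n}]) @_ (m : 'X_{1..n}).

(* < V_0 >_v = (v)_oo Tr_B(v^{L_0} V_0) as a formal power series in v *)
Definition fock_char (R : fieldType) (kappa q1 q2 t1 t2 : R) : pser R :=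
  ps_mul (qpoch 1) (trace_V0_deg kappa q1 q2 t1 t2).

(* Main.v *)
(** Ordering the creation and annihilation operators mode by mode, the trace
    over the k-th oscillator (weight u = v^k) of exp(alpha a_{-k}) exp(beta a_k)
    is a Laguerre generating function: with g = alpha beta kappa k, it equals
    sum_m u^m sum_r g^r/r! C(m,r) = exp(g u/(1-u)) / (1-u).
    The prefactor (v)_oo cancels all the 1/(1-v^k).  Both sides of the identity
    are then compared through their logarithmic derivatives for v d/dv, which
    determine a series with given constant term in characteristic 0: the
    coefficients of v^N are the same sum over the factorisations N = k m, read
    once with k and once with m as the mode number. *)
Require Import Defs.
From HB Require Import structures.
From mathcomp Require Import all_boot all_order all_algebra.
From mathcomp Require Import mpoly.
From mathcomp Require Import boolp.
From mathcomp Require Import zify ring.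
Set Implicit Arguments. Unset Strict Implicit. Unset Printing Implicit Defensive.
Import GRing.Theory.
Local Open Scope ring_scope.

(** * The ring of power series *)

Section PserRing.
Variable R : fieldType.
Implicit Types (f g h : pser R) (p q : {poly R}).

Definition ps_zero : pser R := fun=> 0.
Definition ps_opp f : pser R := fun n => - f n.
Definition ps_add f g : pser R := fun n => f n + g n.
Definition ps_one : pser R := fun n => (n == 0)%:R.

Lemma coef_trunc f N i : (i <= N)%N -> (ps_trunc f N)`_i = f i.
Proof. by move=> le_iN; rewrite coef_poly ltnS le_iN. Qed.

(** Order [n] of a product sees only coefficients up to [n], so polynomials can stand in for series;
    commutativity, associativity and the unit law come from [{poly R}] this way. *)
Lemma ps_mul_coef f g p q n :
    (forall i, (i <= n)%N -> p`_i = f i) -> (forall i, (i <= n)%N -> q`_i = g i) ->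
  (p * q)`_n = ps_mul f g n.
Proof.
move=> fp gq; rewrite coefM; apply: eq_bigr => i _.
by rewrite fp ?gq ?leq_subr // -ltnS.
Qed.

Lemma ps_mul_trunc f g N i : (i <= N)%N ->
  (ps_trunc f N * ps_trunc g N)`_i = ps_mul f g i.
Proof.
by move=> le_iN; apply: ps_mul_coef => j le_ji; rewrite coef_trunc // (leq_trans le_ji).
Qed.

(** Equality of coefficient functions is not decidable; the classical structures open the algebraic
    hierarchy to [pser R]. *)
HB.instance Definition _ := gen_eqMixin (pser R).
HB.instance Definition _ := gen_choiceMixin (pser R).

Fact ps_addA : associative ps_add.
Proof. by move=> f g h; apply/funext => n; apply: addrA. Qed.
Fact ps_addC : commutative ps_add.
Proof. by move=> f g; apply/funext => n; apply: addrC. Qed.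
Fact ps_add0 : left_id ps_zero ps_add.
Proof. by move=> f; apply/funext => n; apply: add0r. Qed.
Fact ps_addN : left_inverse ps_zero ps_opp ps_add.
Proof. by move=> f; apply/funext => n; apply: addNr. Qed.

HB.instance Definition _ :=
  GRing.isZmodule.Build (pser R) ps_addA ps_addC ps_add0 ps_addN.

Fact ps_mulC : commutative (@ps_mul R).
Proof. by move=> f g; apply/funext => n; rewrite -!(@ps_mul_trunc _ _ n) // mulrC. Qed.
Fact ps_mulA : associative (@ps_mul R).
Proof.
move=> f g h; apply/funext => n.
have le_n := @ps_mul_trunc _ _ n.
rewrite -(@ps_mul_coef _ _ (ps_trunc f n) (ps_trunc g n * ps_trunc h n)) ?mulrA.
- by apply: ps_mul_coef => i le_in; [rewrite le_n | rewrite coef_trunc].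
- by move=> i le_in; rewrite coef_trunc.
- by move=> i le_in; rewrite le_n.
Qed.
Fact ps_mul1 : left_id ps_one (@ps_mul R).
Proof.
move=> f; apply/funext => n.
rewrite -(@ps_mul_coef _ _ 1 (ps_trunc f n)) ?mul1r ?coef_trunc // => i le_in.
  by rewrite coef1.
by rewrite coef_trunc.
Qed.
Fact ps_mulDl : left_distributive (@ps_mul R) ps_add.
Proof.
move=> f g h; apply/funext => n; rewrite /ps_mul /ps_add -big_split /=.
by apply: eq_bigr => i _; rewrite mulrDl.
Qed.
Fact ps_oner_neq0 : ps_one != ps_zero.
Proof. by apply/eqP => /(congr1 (@^~ 0%N))/eqP; rewrite /ps_one /ps_zero oner_eq0. Qed.

HB.instance Definition _ := GRing.Zmodule_isComNzRing.Build (pser R)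
  ps_mulA ps_mulC ps_mul1 ps_mulDl ps_oner_neq0.

Fact ps_scaleA a b f : ps_scale a (ps_scale b f) = ps_scale (a * b) f.
Proof. by apply/funext => n; apply: mulrA. Qed.
Fact ps_scale1 : left_id 1 (@ps_scale R).
Proof. by move=> f; apply/funext => n; apply: mul1r. Qed.
Fact ps_scaleDr : right_distributive (@ps_scale R) +%R.
Proof. by move=> a f g; apply/funext => n; apply: mulrDr. Qed.
Fact ps_scaleDl f : {morph (@ps_scale R)^~ f : a b / a + b}.
Proof. by move=> a b; apply/funext => n; apply: mulrDl. Qed.

HB.instance Definition _ := GRing.Zmodule_isLmodule.Build R (pser R)
  ps_scaleA ps_scale1 ps_scaleDr ps_scaleDl.

Fact ps_scaleAl a f g : a *: (f * g) = (a *: f) * g.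
Proof.
by apply/funext => n; rewrite [LHS]big_distrr; apply: eq_bigr => i _; apply: mulrA.
Qed.
HB.instance Definition _ := GRing.Lmodule_isLalgebra.Build R (pser R) ps_scaleAl.

HB.instance Definition _ := GRing.Lalgebra_isComAlgebra.Build R (pser R).

Lemma psD f g n : (f + g) n = f n + g n. Proof. by []. Qed.
Lemma psN f n : (- f) n = - f n. Proof. by []. Qed.
Lemma psM f g n : (f * g) n = \sum_(i < n.+1) f i * g (n - i)%N. Proof. by []. Qed.
Lemma psZ a f n : (a *: f) n = a * f n. Proof. by []. Qed.
Lemma ps1 n : (1 : pser R) n = (n == 0%N)%:R. Proof. by []. Qed.
Lemma ps_sum I (r : seq I) (P : pred I) (F : I -> pser R) n :
  (\sum_(i <- r | P i) F i) n = \sum_(i <- r | P i) F i n.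
Proof. by elim/big_rec2: _ => // i x y _ <-. Qed.

End PserRing.

(** * The derivation v d/dv and logarithmic derivatives *)

Section EulerDerivation.
Variable R : fieldType.
Implicit Types (f g h a b : pser R) (p q : {poly R}).

Definition euler f : pser R := fun n => n%:R * f n.

Lemma eulerE f n : euler f n = n%:R * f n. Proof. by []. Qed.

Lemma euler0 f : euler f 0%N = 0.
Proof. by rewrite eulerE mul0r. Qed.

Lemma eulerD f g : euler (f + g) = euler f + euler g.
Proof. by apply/funext => n; rewrite /euler !psD mulrDr. Qed.

Lemma eulerN f : euler (- f) = - euler f.
Proof. by apply/funext => n; rewrite /euler !psN mulrN. Qed.

Lemma eulerZ c f : euler (c *: f) = c *: euler f.
Proof. by apply/funext => n; rewrite /euler !psZ mulrCA. Qed.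

Lemma euler1 : euler 1 = 0.
Proof. by apply/funext => -[|n]; rewrite /euler ?mul0r // ps1 mulr0. Qed.

Lemma eulerM f g : euler (f * g) = euler f * g + f * euler g.
Proof.
apply/funext => n; rewrite /euler psD !psM big_distrr -big_split /=.
apply: eq_bigr => i _; rewrite -{1}(subnKC (ltn_ord i : (i <= n)%N)) natrD.
by ring.
Qed.

Lemma eulerX f m : euler (f ^+ m) = (f ^+ m.-1 * euler f) *+ m.
Proof.
elim: m => [|m IHm]; first by rewrite expr0 euler1 mulr0n.
rewrite exprS eulerM IHm mulrnAr mulrA; case: m {IHm} => [|m].
  by rewrite mulr0n addr0 mulr1n mulrC.
by rewrite /= -exprS [RHS]mulrS mulrC.
Qed.

(** Each factor raises the order by at least one; this makes the finite sums behind [ps_exp] and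
    [ps_inv] independent of their bound. *)
Lemma exp_ps_val0 f m n : f 0%N = 0 -> (n < m)%N -> (f ^+ m) n = 0.
Proof.
move=> f0; elim: m n => // m IHm n lt_nm; rewrite exprS psM big1 // => -[[|i] /= lt_i] _.
  by rewrite f0 mul0r.
by rewrite IHm ?mulr0 // subnSK // (leq_trans (leq_subr _ _)).
Qed.

(** Congruence modulo [v^(n+1)], which replaces limits when infinite products are cut off. *)
Definition ps_eqn n f g := forall i, (i <= n)%N -> f i = g i.

Lemma ps_eqnM n f f' g g' :
  ps_eqn n f f' -> ps_eqn n g g' -> ps_eqn n (f * g) (f' * g').
Proof.
move=> eqf eqg i le_in; rewrite !psM; apply: eq_bigr => j _.
have le_ji : (j <= i)%N by rewrite -ltnS.
by rewrite eqf ?eqg // (leq_trans _ le_in) // leq_subr.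
Qed.

Lemma ps_eqn_trunc n m f g : ps_eqn n f g -> (m <= n)%N -> ps_trunc f m = ps_trunc g m.
Proof.
move=> eqfg le_mn; apply/polyP => i; rewrite !coef_poly; case: ltnP => // le_im.
by rewrite eqfg // (leq_trans _ le_mn).
Qed.

Lemma ps_inv_eqn n f g : ps_eqn n f g -> ps_eqn n (ps_inv f) (ps_inv g).
Proof. by move=> eqfg i le_in; rewrite /ps_inv (ps_eqn_trunc eqfg). Qed.

Lemma ps_powk_eqn n f g k : ps_eqn n f g -> ps_eqn n (ps_powk f k) (ps_powk g k).
Proof.
move=> eqfg i le_in; rewrite /ps_powk /ps_exp (@ps_eqn_trunc n _ _ (ps_scale k (ps_log g))) //.
by move=> j le_jn; rewrite /ps_scale /ps_log (ps_eqn_trunc eqfg).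
Qed.

Lemma ps_eqn_prod n (I : Type) (r : seq I) (F G : I -> pser R) :
  (forall i, ps_eqn n (F i) (G i)) -> ps_eqn n (\prod_(i <- r) F i) (\prod_(i <- r) G i).
Proof. by move=> eqFG; elim/big_rec2: _ => // i f g _; apply: ps_eqnM. Qed.

Lemma coefX_eqn n p f m :
  (forall i, (i <= n)%N -> p`_i = f i) -> forall i, (i <= n)%N -> (p ^+ m)`_i = (f ^+ m) i.
Proof.
move=> pf; elim: m => [|m IHm] i le_in; first by rewrite expr0 coef1.
rewrite !exprS; apply: ps_mul_coef => j le_ji.
  by rewrite pf // (leq_trans le_ji).
by rewrite IHm // (leq_trans le_ji).
Qed.

Lemma ps_expE h n M : h 0%N = 0 -> (n < M)%N ->
  ps_exp h n = \sum_(m < M) (m`!%:R)^-1 * (h ^+ m) n.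
Proof.
move=> h0 lt_nM; rewrite /ps_exp coef_sum.
rewrite (big_ord_widen M (fun m => ((m`!%:R)^-1 *: ps_trunc h n ^+ m)`_n)) //.
rewrite big_mkcond /=; apply: eq_bigr => m _; case: ltnP => [lt_mn|lt_nm].
  by rewrite coefZ (@coefX_eqn n _ h) // => i le_in; rewrite coef_trunc.
by rewrite exp_ps_val0 ?mulr0.
Qed.

Lemma ps_invE f n : f 0%N = 1 -> ps_inv f n = (\sum_(m < n.+1) (1 - f) ^+ m) n.
Proof.
move=> f0; rewrite /ps_inv coef_sum ps_sum; apply: eq_bigr => m _.
by rewrite (@coefX_eqn n _ (1 - f)) // => i le_in; rewrite coefB coef1 coef_trunc.
Qed.

Lemma ps_logE f n : f 0%N = 1 ->
  ps_log f n = \sum_(m < n) (-1) ^+ m / m.+1%:R * ((f - 1) ^+ m.+1) n.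
Proof.
move=> f0; rewrite /ps_log coef_sum; apply: eq_bigr => m _.
rewrite coefZ (@coefX_eqn n _ (f - 1)) // => i le_in.
by rewrite coefB coef1 coef_trunc.
Qed.

Lemma ps_invE_widen f n M : f 0%N = 1 -> (n < M)%N ->
  ps_inv f n = (\sum_(m < M) (1 - f) ^+ m) n.
Proof.
move=> f0 lt_nM; rewrite ps_invE // !ps_sum.
rewrite (big_ord_widen M (fun m => ((1 - f) ^+ m) n)) // big_mkcond /=.
apply: eq_bigr => m _; case: ltnP => // lt_nm.
by rewrite exp_ps_val0 // psD psN f0 subrr.
Qed.

(** The geometric sum telescopes: [f] times it is [1 - (1 - f)^(n+1)], and the last power has order
    above [n]. *)
Lemma ps_mulV f : f 0%N = 1 -> f * ps_inv f = 1.
Proof.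
move=> f0; apply/funext => n.
rewrite (@ps_eqnM n f f _ (\sum_(m < n.+1) (1 - f) ^+ m)) // => [|i le_in].
  have -> : f * \sum_(m < n.+1) (1 - f) ^+ m = 1 - (1 - f) ^+ n.+1.
    have := subrXX 1 (1 - f) n.+1; rewrite expr1n => ->; rewrite subKr.
    congr (_ * _).
    by apply: eq_bigr => m _; rewrite expr1n mul1r.
  by rewrite psD psN exp_ps_val0 ?oppr0 ?addr0 // psD psN f0 subrr.
by rewrite (ps_invE_widen (M := n.+1)).
Qed.

Lemma ps_inv0 f : f 0%N = 1 -> ps_inv f 0%N = 1.
Proof. by move=> f0; rewrite ps_invE // big_ord1 expr0. Qed.

Lemma psM0 f g : (f * g) 0%N = f 0%N * g 0%N.
Proof. by rewrite psM big_ord1. Qed.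

Definition logder f a := euler f = a * f.

Lemma logderM f g a b : logder f a -> logder g b -> logder (f * g) (a + b).
Proof. by rewrite /logder eulerM => -> ->; ring. Qed.

Lemma logder1 : logder 1 0.
Proof. by rewrite /logder euler1 mul0r. Qed.

Lemma logder_prod (I : Type) (r : seq I) (F A : I -> pser R) :
  (forall i, logder (F i) (A i)) -> logder (\prod_(i <- r) F i) (\sum_(i <- r) A i).
Proof.
move=> FA; elim/big_rec2: _ => [|i a f _ fa]; first exact: logder1.
exact: logderM.
Qed.

Lemma logderV f a : f 0%N = 1 -> logder f a -> logder (ps_inv f) (- a).
Proof.
move=> f0 fa; have fV := ps_mulV f0; rewrite /logder.
have: ps_inv f * euler (f * ps_inv f)
    = f * ps_inv f * (a * ps_inv f + euler (ps_inv f)) by rewrite eulerM fa; ring.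
by rewrite fV euler1 mulr0 mul1r addrC mulNr => /esym/eqP; rewrite addr_eq0 => /eqP.
Qed.

(** * Exponential, logarithm and uniqueness in characteristic zero *)

Hypothesis char0 : [pchar R] =i pred0.

Lemma natf_neq0_pchar0 n : n.+1%:R != 0 :> R.
Proof. by have /pcharf0P -> := char0. Qed.

(** In [(i+1) f_(i+1) = sum_j a_j f_(i+1-j)] the vanishing of [a_0] leaves only lower coefficients
    of [f] on the right, and [i+1] is invertible. *)
Lemma logder_inj_eqn n f g a b : f 0%N = g 0%N -> logder f a -> logder g b ->
  ps_eqn n a b -> a 0%N = 0 -> ps_eqn n f g.
Proof.
move=> fg0 fa gb ab a0; elim/ltn_ind=> -[//|i] IHi lt_in.
apply: (mulfI (natf_neq0_pchar0 i)).
have := congr1 (@^~ i.+1) fa; have := congr1 (@^~ i.+1) gb; rewrite /euler => -> ->.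
rewrite !psM; apply: eq_bigr => -[[|j] /= lt_j] _; first by rewrite -ab // a0 !mul0r.
rewrite ab 1?IHi ?subSS ?ltnS ?leq_subr //; first by rewrite (leq_trans _ (ltnW lt_in)) ?leq_subr.
by rewrite (leq_trans _ lt_in).
Qed.

Lemma ps_exp0 h : ps_exp h 0%N = 1.
Proof. by rewrite /ps_exp big_ord1 invr1 scale1r coef1. Qed.

Lemma logder_exp h : h 0%N = 0 -> logder (ps_exp h) (euler h).
Proof.
move=> h0; apply/funext => -[|n].
  by rewrite psM0 !euler0 mul0r.
rewrite eulerE (ps_expE h0 (ltnSn _)) big_distrr /= psM.
rewrite [LHS]big_ord_recl expr0 ps1 !mulr0 add0r [RHS]big_ord_recl euler0 mul0r add0r.
(* As [euler h] has no constant term, only orders up to [n] of the exponential remain, and one bound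
   serves them all. *)
under [RHS]eq_bigr => i _.
  rewrite (@ps_expE _ _ n.+1) // ?subSS ?ltnS ?leq_subr // big_distrr /=.
  over.
rewrite exchange_big; apply: eq_bigr => m _ /=; rewrite mulrCA.
have -> : n.+1%:R * (h ^+ (bump 0 m)) n.+1 = euler (h ^+ m.+1) n.+1 by [].
rewrite eulerX /= -scaler_nat psZ mulrA factS natrM invfM [X in X * _]mulrAC.
rewrite mulVf ?natf_neq0_pchar0 // mul1r [h ^+ m * _]mulrC psM.
rewrite [in LHS]big_ord_recl euler0 mul0r add0r big_distrr /=.
by apply: eq_bigr => i _; rewrite /bump /= add1n subSS mulrCA.
Qed.

(** Differentiating the logarithm termwise gives [euler f] times the geometric sum for the inverse
    of [f]. *)
Lemma euler_log f a : f 0%N = 1 -> logder f a -> euler (ps_log f) = a.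
Proof.
move=> f0 fa; have -> : a = euler f * ps_inv f by rewrite fa -mulrA ps_mulV ?mulr1.
apply/funext => -[|n]; first by rewrite psM0 !euler0 mul0r.
rewrite (@ps_eqnM n.+1 _ (euler f) _ (\sum_(m < n.+2) (1 - f) ^+ m)) //; last first.
  by move=> i le_in; rewrite (ps_invE_widen (M := n.+2)).
(* The inverse has one term more than the logarithm; its product with [euler f] starts at order
   [n+2]. *)
rewrite big_ord_recr /= mulrDr psD [X in _ + X]psM [X in _ + X]big1 ?addr0; last first.
  move=> -[[|i] /= lt_i] _; first by rewrite euler0 mul0r.
  rewrite exp_ps_val0 ?mulr0 //; first by rewrite psD psN f0 subrr.
  by rewrite subSS ltnS leq_subr.
rewrite eulerE ps_logE // !big_distrr ps_sum /=; apply: eq_bigr => m _.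
rewrite mulrCA.
have -> : n.+1%:R * ((f - 1) ^+ m.+1) n.+1 = euler ((f - 1) ^+ m.+1) n.+1 by [].
rewrite eulerX /= -scaler_nat psZ mulrA mulfVK ?natf_neq0_pchar0 //.
rewrite eulerD eulerN euler1 subr0 -psZ scalerAl.
have -> : 1 - f = -1 *: (f - 1) by rewrite scaleN1r opprB.
by rewrite exprZn mulrC.
Qed.

End EulerDerivation.

(** * Matrix coefficients of the exponentials *)

Section ExpSeries.
Variables (R : fieldType) (N : nat) (kappa : R) (c : nat -> R).
Hypothesis char0 : [pchar R] =i pred0.
Implicit Types (m l : 'X_{1..N}) (p : {mpoly R[N]}).

Lemma energyD m l : energy (m + l) = (energy m + energy l)%N.
Proof.
by rewrite /energy -big_split; apply: eq_bigr => i _; rewrite mnmDE mulnDr.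
Qed.

Lemma energy0 : @energy N 0 = 0%N.
Proof. by rewrite /energy big1 // => i _; rewrite mnm0E muln0. Qed.

Lemma energyU (i : 'I_N) : energy U_(i) = i.+1.
Proof.
rewrite /energy (bigD1 i) //= mnm1E eqxx muln1 big1 ?addn0 // => j ne_ji.
by rewrite mnm1E eq_sym (negPf ne_ji) muln0.
Qed.

Lemma leq_mdeg_energy m : (mdeg m <= energy m)%N.
Proof. by rewrite mdegE; apply: leq_sum => i _; rewrite leq_pmull. Qed.

Lemma leq_energy m l : (m <= l)%MM -> (energy m <= energy l)%N.
Proof. by move/mnm_lepP=> le_ml; apply: leq_sum => i _; rewrite leq_mul2l le_ml orbT. Qed.

(** Passes from modes [k] to variables [j = k-1]. Mode 0 is set apart because [0.-1 = 0] would
    select the first variable; modes above [N] drop out through [insub]. *)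
Lemma sum_insub_pred (V : nmodType) i (G : 'I_N -> nat -> V) :
  \sum_(k < i.+1) (if (k : nat) == 0%N then 0 else
     if insub (k : nat).-1 is Some j then G j (i - k)%N else 0)
  = \sum_(j < N | (j < i)%N) G j (i - j.+1)%N.
Proof.
rewrite big_ord_recl add0r /=.
under eq_bigr => k _.
  have -> : (if insub (bump 0 k).-1 is Some j then G j (i - bump 0 k)%N else 0) =
            \sum_(j < N | (j == k :> nat)) G j (i - k.+1)%N.
    rewrite /bump add1n /=; case: insubP => [j _ jk|].
      by rewrite (big_pred1 j) // => j'; rewrite -jk.
    by move=> Nlt; rewrite big_pred0 // => j; apply: contraNF Nlt => /eqP <-.
  over.
rewrite (exchange_big_dep (fun j : 'I_N => (j < i)%N)) /=; last first.
  by move=> k j _ /eqP ->.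
apply: eq_bigr => j lt_ji.
by rewrite (big_pred1 (Ordinal lt_ji)).
Qed.

Lemma cre_powS r i p :
  opser_pow (cre_series c) r.+1 i p =
  \sum_(j < N | (j < i)%N) (c j.+1 / j.+1%:R) *:
     ('X_j * opser_pow (cre_series c) r (i - j.+1)%N p).
Proof.
rewrite -(sum_insub_pred i (fun j i' => (c j.+1 / j.+1%:R) *:
  ('X_j * opser_pow (cre_series c) r i' p))) /=.
apply: eq_bigr => -[[|k] lt_k] _ //=; rewrite /cre_series /acre /=.
by case: insubP => [j _ <-|] //; rewrite scaler0.
Qed.

(** The factor [k] in [aann] cancels the [1/k] of the series, so no denominator is left. *)
Lemma ann_powS r i p :
  opser_pow (ann_series kappa c) r.+1 i p =
  \sum_(j < N | (j < i)%N) (kappa * c j.+1) *: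
     (opser_pow (ann_series kappa c) r (i - j.+1)%N p)^`M(j).
Proof.
rewrite -(sum_insub_pred i (fun j i' => (kappa * c j.+1) *:
  (opser_pow (ann_series kappa c) r i' p)^`M(j))) /=.
apply: eq_bigr => -[[|k] lt_k] _ //=; rewrite /ann_series /aann /=.
case: insubP => [j _ <-|]; last by rewrite scaler0.
by rewrite scalerA mulrCA mulfVK ?natf_neq0_pchar0.
Qed.

(** Creation operators are multiplications, so the series acts through its value on the vacuum
    [1]. *)
Lemma cre_pow_mul r i p :
  opser_pow (cre_series c) r i p = opser_pow (cre_series c) r i 1 * p.
Proof.
elim: r i p => [|r IHr] i p; first by rewrite /= /opser_one; case: eqP; rewrite ?mul1r ?mul0r.
rewrite !cre_powS big_distrl; apply: eq_bigr => j _ /=.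
by rewrite IHr -scalerAl mulrA.
Qed.

Lemma cre_exp_mul i p :
  opser_exp (cre_series c) i p = opser_exp (cre_series c) i 1 * p.
Proof.
rewrite /opser_exp big_distrl; apply: eq_bigr => m _ /=.
by rewrite cre_pow_mul -scalerAl.
Qed.

Lemma mnm_subU m (j : 'I_N) : (0 < m j)%N -> exists m', m = (U_(j) + m')%MM.
Proof.
move=> m_gt0; exists (m - U_(j))%MM; rewrite addmC submK //.
by apply/mnm_lepP => i; rewrite mnm1E; case: eqP => // <-.
Qed.

(** Coefficient of [x^m] in [exp (sum_j w_j x_j)]. *)
Definition mfact_weight (w : 'I_N -> R) m : R := \prod_j (w j ^+ m j / (m j)`!%:R).

Lemma mfact_weightDU w m j :
  (m j).+1%:R * mfact_weight w (U_(j) + m)%MM = w j * mfact_weight w m.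
Proof.
rewrite /mfact_weight (bigD1 j) //= [in RHS](bigD1 j) //= mnmDE mnm1E eqxx add1n.
rewrite (eq_bigr (fun k => w k ^+ m k / (m k)`!%:R)); last first.
  by move=> k ne_kj; rewrite mnmDE mnm1E eq_sym (negPf ne_kj).
rewrite exprS factS natrM invfM.
have := natf_neq0_pchar0 char0 (m j); move: _.+1%:R (w j ^+ _) (_`!%:R^-1) => x y z x_neq0.
by field.
Qed.

(** Multinomial theorem by induction on [r]: peeling off variable [j] yields a common value times
    [m j], and the [m j] add up to the degree [r+1], turning [r!] into [(r+1)!]. *)
Lemma cre_pow_coef r i m :
  (opser_pow (cre_series c) r i 1)@_m =
  ((mdeg m == r) && (energy m == i))%:R *
  (r`!%:R * mfact_weight (fun j => c j.+1 / j.+1%:R) m).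
Proof.
elim: r i m => [|r IHr] i m.
  rewrite /= /opser_one mdeg_eq0 (fun_if (fun p => p@_m)) mcoeff1 mcoeff0.
  have [->|] := eqVneq m 0%MM; last by rewrite andFb mul0r; case: ifP.
  rewrite energy0 fact0 mul1r /mfact_weight big1 ?mulr1.
    by rewrite eq_sym; case: eqP.
  by move=> j _; rewrite mnm0E expr0 fact0 invr1 mulr1.
rewrite cre_powS raddf_sum /=.
set W := mfact_weight _.
have step (j : 'I_N) : (if (j < i)%N then ((c j.+1 / j.+1%:R) *: ('X_j *
    opser_pow (cre_series c) r (i - j.+1)%N 1))@_m else 0) =
    ((mdeg m == r.+1) && (energy m == i))%:R * (r`!%:R * W m) * (m j)%:R.
  have [m_gt0|] := ltnP 0 (m j); last first.
    rewrite leqn0 => /eqP mj0; rewrite mj0 mulr0; case: ifP => // _.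
    rewrite mcoeffZ; apply/eqP; rewrite mulf_eq0 mcoeff_eq0 ['X_j * _]mulrC; apply/orP; right.
    rewrite (perm_mem (msuppMX _ _)); apply/negP => /mapP[m' _ mE].
    by move: mj0; rewrite mE mnmDE mnm1E eqxx.
  have [m' mE] := mnm_subU m_gt0; move: m_gt0 => _.
  rewrite mcoeffZ ['X_j * _]mulrC {1}mE mcoeffMX IHr -/W.
  rewrite mE mdegD mdeg1 energyD energyU add1n eqSS mnmDE mnm1E eqxx add1n.
  rewrite -[RHS]mulrA [_ * _.+1%:R]mulrC [X in _ = _ * X]mulrCA mfact_weightDU.
  case: ltnP => [lt_ji|le_ij]; last first.
    by rewrite [_ == i]gtn_eqF ?andbF ?mul0r // addSn ltnS (leq_trans le_ij) ?leq_addr.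
  have -> : (energy m' == i - j.+1)%N = (j.+1 + energy m' == i)%N.
    by rewrite -(eqn_add2l j.+1) subnKC.
  by rewrite -/W; ring.
rewrite big_mkcond /= (eq_bigr _ (fun j _ => step j)) -big_distrr -natr_sum -mdegE /=.
case: eqP => [->|]; last by rewrite !mul0r.
by rewrite factS natrM; ring.
Qed.


(* The binomial absorbs m!/l!; it also vanishes unless l <= m, which makes the
   truncated exponents m j - l j harmless. *)
Definition mbin_weight (w : 'I_N -> R) m l : R :=
  \prod_j (w j ^+ (m j - l j) * 'C(m j, l j)%:R).

(** Reduces to [(l+1) C(m,l+1) = (m-l) C(m,l)] in the coordinate [j]; when [l j >= m j] both sides
    are 0. *)
Lemma mbin_weightDU w m l j :
  (l j).+1%:R * (w j * mbin_weight w m (l + U_(j))) = (m j - l j)%:R * mbin_weight w m l.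
Proof.
rewrite /mbin_weight (bigD1 j) //= [in RHS](bigD1 j) //= mnmDE mnm1E eqxx addn1.
rewrite (eq_bigr (fun k => w k ^+ (m k - l k) * 'C(m k, l k)%:R)); last first.
  by move=> k ne_kj; rewrite mnmDE mnm1E eq_sym (negPf ne_kj) addn0.
have [lt_lm|le_ml] := ltnP (l j) (m j); last first.
  by rewrite bin_small // (eqP le_ml) !(mulr0, mul0r).
have binE : (l j).+1%:R * 'C(m j, (l j).+1)%:R = (m j - l j)%:R * 'C(m j, l j)%:R :> R.
  by rewrite -!natrM mul_bin_left.
have -> : w j ^+ (m j - l j) = w j * w j ^+ (m j - (l j).+1) by rewrite -exprS subnSK.
move: (\prod_(i < N | _) _) (w j) (w j ^+ _) => P x y.
transitivity (((l j).+1%:R * 'C(m j, (l j).+1)%:R) * (x * y * P)); first by ring.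
by rewrite binE; ring.
Qed.

(** Induction as in [cre_pow_coef]: a coefficient of the [j]-th derivative at [l] is one at
    [l + U_(j)], and the resulting factors [(m - l) j] add up to the degree of [m - l]. *)
Lemma ann_pow_coef r i m l :
  (opser_pow (ann_series kappa c) r i 'X_[m])@_l =
  ((mdeg (m - l) == r) && (energy (m - l) == i))%:R *
  (r`!%:R * mbin_weight (fun j => kappa * c j.+1) m l).
Proof.
set W := mbin_weight _; elim: r i l => [|r IHr] i l.
  rewrite /= /opser_one mdeg_eq0 (fun_if (fun p => p@_l)) mcoeffX mcoeff0 fact0 mul1r.
  have [->|ne_ml] := eqVneq m l.
    rewrite -{1 3}[l]add0m addmK eqxx energy0 eq_sym /W /mbin_weight big1 ?mulr1; first by case: eqP.
    by move=> j _; rewrite subnn binn mulr1.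
  (* Truncated subtraction also gives [m - l = 0] when [l] exceeds [m]; then some [l j > m j], and
     its binomial kills the weight. *)
  rewrite if_same; case: eqP => [sub0|]; last by rewrite mul0r.
  suff [j lt_ml]: exists j, (m j < l j)%N.
    by rewrite /W /mbin_weight (bigD1 j) //= bin_small // mulr0 mul0r mulr0.
  apply/existsP; apply: contraNT ne_ml; rewrite negb_exists => /forallP le_lm.
  apply/eqP/mnmP => j; apply/eqP; rewrite eqn_leq leqNgt andbC leqNgt le_lm /=.
  by rewrite -leqNgt -subn_eq0 -mnmBE sub0 mnm0E.
rewrite ann_powS raddf_sum /=.
have step (j : 'I_N) : (if (j < i)%N then ((kappa * c j.+1) *: (opser_pow
    (ann_series kappa c) r (i - j.+1)%N 'X_[m])^`M(j))@_l else 0) =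
    ((mdeg (m - l) == r.+1) && (energy (m - l) == i))%:R *
    (r`!%:R * ((m - l)%MM j)%:R * W m l).
  rewrite mcoeffZ mcoeff_deriv IHr mnmBE -[_ * _%:R * W _ _]mulrA /W -mbin_weightDU -/W.
  have [lt_lm|le_ml] := ltnP (l j) (m j); last first.
    suff -> : W m (l + U_(j))%MM = 0 by rewrite !(mulr0, mul0rn, if_same).
    rewrite /W /mbin_weight (bigD1 j) //= bin_small ?mulr0 ?mul0r //.
    by rewrite mnmDE mnm1E eqxx addn1.
  have -> : (m - l)%MM = (U_(j) + (m - (l + U_(j))))%MM.
    apply/mnmP => k; rewrite !(mnmBE, mnmDE) mnm1E; case: eqP => [<-|_].
      by rewrite addn1 add1n subnSK.
    by rewrite addn0.
  rewrite mdegD mdeg1 energyD energyU add1n eqSS.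
  case: ltnP => [lt_ji|le_ij]; last first.
    by rewrite [_ == i]gtn_eqF ?andbF ?mul0r // addSn ltnS (leq_trans le_ij) ?leq_addr.
  have -> : (energy (m - (l + U_(j))) == i - j.+1)%N
          = (j.+1 + energy (m - (l + U_(j))) == i)%N.
    by rewrite -(eqn_add2l j.+1) subnKC.
  by rewrite -mulr_natr; ring.
rewrite big_mkcond /= (eq_bigr _ (fun j _ => step j)) -big_distrr /=.
rewrite -big_distrl -big_distrr /= -natr_sum -mdegE.
case: eqP => [->|]; last by rewrite !mul0r.
by rewrite factS natrM; ring.
Qed.

(** Only the power [r = d] of an exponential contributes. In the uses [d] is a degree and [i] the
    energy, so the cutoff of [opser_exp] loses nothing. *)
Lemma sum_exp_delta d i (x : R) : (d <= i)%N ->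
  \sum_(r < i.+1) (r`!%:R)^-1 * ((d == r)%:R * (r`!%:R * x)) = x.
Proof.
move=> le_di; rewrite (bigD1 (Ordinal (le_di : (d < i.+1)%N))) //= eqxx mul1r mulKf.
  by rewrite big1 ?addr0 // => r; rewrite -val_eqE eq_sym /= => /negPf->; rewrite mul0r mulr0.
by have /pcharf0P -> := char0; rewrite -lt0n fact_gt0.
Qed.

Lemma cre_exp_coef i m :
  (opser_exp (cre_series c) i 1)@_m =
  (energy m == i)%:R * mfact_weight (fun j => c j.+1 / j.+1%:R) m.
Proof.
rewrite /opser_exp raddf_sum /=.
under eq_bigr => r _ do rewrite mcoeffZ cre_pow_coef.
case: eqP => [<-|_]; last by rewrite mul0r big1 // => r _; rewrite andbF mul0r mulr0.
by under eq_bigr => r _ do rewrite andbT; rewrite sum_exp_delta ?mul1r ?leq_mdeg_energy.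
Qed.

Lemma ann_exp_coef i m l :
  (opser_exp (ann_series kappa c) i 'X_[m])@_l =
  (energy (m - l) == i)%:R * mbin_weight (fun j => kappa * c j.+1) m l.
Proof.
rewrite /opser_exp raddf_sum /=.
under eq_bigr => r _ do rewrite mcoeffZ ann_pow_coef.
case: eqP => [<-|_]; last by rewrite mul0r big1 // => r _; rewrite andbF mul0r mulr0.
by under eq_bigr => r _ do rewrite andbT; rewrite sum_exp_delta ?mul1r ?leq_mdeg_energy.
Qed.

End ExpSeries.

(** * Diagonal coefficients and the trace *)

Section Trace.
Variables (R : fieldType).
Hypothesis char0 : [pchar R] =i pred0.

Lemma mcoeffM_lem N (p q : {mpoly R[N]}) m :
  (p * q)@_m = \sum_(mu : 'X_{1..N < (mdeg m).+1} | (mu <= m)%MM) p@_mu * q@_(m - mu).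
Proof. exact: mcoeff_poly_mul_lin. Qed.

(** Distributivity of products over sums needs a sum over functions. These bound each exponent
    rather than the total degree, but [P] selects the same monomials. *)
Lemma sum_bmnm_ffun N d (P : pred 'X_{1..N}) (F : 'X_{1..N} -> R) :
    (forall m, P m -> (mdeg m <= d)%N) ->
  \sum_(m : 'X_{1..N < d.+1} | P m) F m =
  \sum_(f : {ffun 'I_N -> 'I_d.+1} | P [multinom (f i : nat) | i < N])
     F [multinom (f i : nat) | i < N].
Proof.
move=> Pd; pose mn (f : {ffun 'I_N -> 'I_d.+1}) := [multinom (f i : nat) | i < N].
have leq_md (m : 'X_{1..N < d.+1}) i : (m i < d.+1)%N.
  by rewrite (leq_ltn_trans _ (bmdeg m)) // mdegE (bigD1 i) //= leq_addr.
pose h f : 'X_{1..N < d.+1} := insubd bm0 (mn f).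
have hE f : P (mn f) -> h f = mn f :> 'X_{1..N}.
  by move=> Pf; rewrite /h val_insubd ltnS Pd.
pose h' (m : 'X_{1..N < d.+1}) := [ffun i => Ordinal (leq_md m i)].
have mnK m : mn (h' m) = m :> 'X_{1..N} by apply/mnmP => i; rewrite mnmE ffunE.
rewrite (reindex_onto h h') /=; last first.
  by move=> m Pm; apply/val_inj; rewrite /= hE ?mnK.
apply: eq_big => [f|f /andP[_ /eqP hf]]; rewrite -/(mn f); last by rewrite -hf mnK hf.
apply/andP/idP => [[Ph /eqP hf]|Pf]; first by rewrite -hf mnK.
rewrite hE //; split=> //; apply/eqP/ffunP => i; apply/val_inj.
by rewrite ffunE /= hE // mnmE.
Qed.

(* The Laguerre polynomial L_k(-g). *)
Definition mode_diag (g : R) k : R := \sum_(r < k.+1) g ^+ r / r`!%:R * 'C(k, r)%:R.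

Lemma mode_diag_widen g k M : (k <= M)%N ->
  mode_diag g k = \sum_(r < M.+1) g ^+ r / r`!%:R * 'C(k, r)%:R.
Proof.
move=> le_kM; rewrite /mode_diag.
rewrite (big_ord_widen M.+1 (fun r => g ^+ r / r`!%:R * 'C(k, r)%:R)) // big_mkcond.
by apply: eq_bigr => r _; case: ltnP => // lt_kr; rewrite bin_small ?mulr0.
Qed.

Section Diagonal.
Variables (kappa q1 q2 t1 t2 : R).

(** This is [g = alpha beta kappa k] with [alpha = (q1^k - q2^k)/k] and [beta = (t2^k - t1^k)/k]. *)
Definition mode_coupling k : R :=
  kappa * (q1 ^+ k - q2 ^+ k) * (t2 ^+ k - t1 ^+ k) / k%:R.

(** On the diagonal the quanta [mu] removed by annihilation are exactly those put back by creation,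
    and the weights factor over the modes. *)
Lemma V0_diag n (m : 'X_{1..n}) : (energy m <= n)%N ->
  (V0_on_deg kappa q1 q2 t1 t2 n 'X_[m])@_m =
  \prod_(j < n) mode_diag (mode_coupling j.+1) (m j).
Proof.
move=> le_en; rewrite /V0_on_deg raddf_sum /=.
set c1 := fun k => q1 ^+ k - q2 ^+ k; set c2 := fun k => t2 ^+ k - t1 ^+ k.
pose d := mdeg m.
transitivity (\sum_(mu : 'X_{1..n < d.+1} | (mu <= m)%MM)
   \prod_(j < n) (mode_coupling j.+1 ^+ mu j / (mu j)`!%:R * 'C(m j, mu j)%:R)).
  under eq_bigr => j _ do
    rewrite cre_exp_mul mcoeffM_lem.
  rewrite exchange_big; apply: eq_bigr => mu le_mum /=.
  have subK : (m - (m - mu))%MM = mu.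
    by rewrite submBA // addmC addmK.
  have le_mun : (energy mu < n.+1)%N by rewrite ltnS (leq_trans (leq_energy le_mum)).
  (* Each [mu] meets only the index [j = energy mu], in range since [energy mu <= energy m <= n]. *)
  rewrite (bigD1 (Ordinal le_mun)) //= [X in _ + X]big1 ?addr0; last first.
    move=> j; rewrite -val_eqE eq_sym /= => /negPf ne_j.
    by rewrite cre_exp_coef // ne_j !mul0r.
  rewrite cre_exp_coef // ann_exp_coef // subK eqxx !mul1r /mfact_weight /mbin_weight.
  rewrite -big_split; apply: eq_bigr => j _ /=; rewrite !mnmBE subKn ?(mnm_lepP le_mum) //.
  rewrite bin_sub ?(mnm_lepP le_mum) // mulrA; congr (_ * _).
  rewrite mulrAC -exprMn; congr (_ ^+ _ / _).
  by rewrite /mode_coupling -/(c1 _) -/(c2 _); ring.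
rewrite (@sum_bmnm_ffun _ _ (fun mu => (mu <= m)%MM) (fun mu =>
  \prod_(j < n) (mode_coupling j.+1 ^+ mu j / (mu j)`!%:R * 'C(m j, mu j)%:R))).
  rewrite (eq_bigr _ (fun j _ => mode_diag_widen _ (_ : m j <= d)%N)); last first.
    by move=> j _; rewrite /d mdegE (bigD1 j) //= leq_addr.
  (* Distributing also produces exponents not below [m]; a vanishing binomial removes them. *)
  rewrite bigA_distr_bigA big_mkcond; apply: eq_bigr => f _ /=.
  case: ifP => [_|/negP le_fm]; first by apply: eq_bigr => j _; rewrite mnmE.
  suff [j lt_mf] : exists j, (m j < f j)%N by rewrite (bigD1 j) //= bin_small // mulr0 mul0r.
  apply/existsP; apply: contra_notT le_fm; rewrite negb_exists => /forallP le_fm.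
  by apply/mnm_lepP => j; rewrite mnmE leqNgt le_fm.
by move=> mu /mnm_lepP le_mum; rewrite /d !mdegE leq_sum.
Qed.

End Diagonal.
End Trace.

(** * One-mode generating functions *)

Section QSeries.
Variables (R : fieldType).
Implicit Types (f : pser R) (c g : R).

Definition psX : pser R := fun n => (n == 1%N)%:R.

Lemma psXnM e f j : (psX ^+ e * f) j = if (e <= j)%N then f (j - e)%N else 0.
Proof.
elim: e j => [|e IHe] j; first by rewrite expr0 mul1r subn0.
rewrite exprS -mulrA psM; case: j => [|j]; first by rewrite big_ord1 mul0r.
rewrite big_ord_recl mul0r add0r big_ord_recl mul1r big1 ?addr0 => [|i _].
  by rewrite /bump /= subn1 IHe ltnS subSS.
by rewrite mul0r.
Qed.

Lemma psXn e j : (psX ^+ e) j = (j == e)%:R.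
Proof.
rewrite -[psX ^+ e]mulr1 psXnM ps1 subn_eq0 [in RHS]eqn_leq.
by case: leqP => [_|/ltnW lt_je]; rewrite ?andbT ?andbF.
Qed.

Lemma eulerXn e : euler (psX ^+ e) = e%:R *: psX ^+ e.
Proof. by apply/funext => j; rewrite eulerE psZ psXn; case: eqP => [->|] //; rewrite !mulr0. Qed.

Lemma ps_prod0 (I : Type) (r : seq I) (P : pred I) (F : I -> pser R) :
  (\prod_(i <- r | P i) F i) 0%N = \prod_(i <- r | P i) F i 0%N.
Proof. by elim/big_rec2: _ => // i x f _ <-; apply: psM0. Qed.

(** Factors of index at least [i] are 1 up to order [i]. *)
Lemma ps_prod_stable (F : nat -> pser R) n i :
  (forall k, ps_eqn k (F k) 1) -> (i <= n)%N ->
  (\prod_(k < n) F k) i = (\prod_(k < i) F k) i.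
Proof.
move=> F1; elim: n => [|n IHn]; first by rewrite leqn0 => /eqP->.
rewrite leq_eqVlt => /predU1P[-> //|]; rewrite ltnS => le_in.
by rewrite big_ord_recr /= (ps_eqnM (fun _ _ => erefl) (F1 n)) // mulr1 IHn.
Qed.

Lemma coef_prod_eqn n (p : nat -> {poly R}) (F : nat -> pser R) :
  (forall k i, (p k)`_i = F k i) -> forall i, (\prod_(k < n) p k)`_i = (\prod_(k < n) F k) i.
Proof.
move=> pF; elim: n => [|n IHn] i; first by rewrite !big_ord0 coef1.
by rewrite !big_ord_recr /=; apply: ps_mul_coef.
Qed.

Lemma qfactor_eqn1 c k : ps_eqn k (1 - c *: psX ^+ k.+1) 1.
Proof.
by move=> i le_ik; rewrite psD psN psZ psXn ltn_eqF ?mulr0 ?subr0.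
Qed.

Lemma qpoch_eqn n c : ps_eqn n (qpoch c) (\prod_(k < n) (1 - c *: psX ^+ k.+1)).
Proof.
move=> i le_in; rewrite (ps_prod_stable (F := fun k => 1 - c *: psX ^+ k.+1)) //.
  apply: (@coef_prod_eqn i (fun k => 1 - c *: 'X^(k.+1)) (fun k => 1 - c *: psX ^+ k.+1)).
  move=> k j.
  by rewrite coefB coef1 coefZ coefXn psD psN psZ psXn.
by move=> k; apply: qfactor_eqn1.
Qed.

(** The series [1/(1 - c v^k)]. *)
Definition geom c k : pser R := fun j => if (k %| j)%N then c ^+ (j %/ k) else 0.

Lemma geom_inv c k : (0 < k)%N -> (1 - c *: psX ^+ k) * geom c k = 1.
Proof.
move=> k_gt0; apply/funext => j; rewrite mulrBl mul1r -scalerAl psD psN psZ psXnM ps1 /geom.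
case: j => [|j]; first by rewrite dvdn0 div0n [(k <= 0)%N]leqNgt k_gt0 /= mulr0 subr0.
have [le_kj|lt_jk] := leqP k j.+1; last by rewrite gtnNdvd // mulr0 subr0.
rewrite dvdn_subl //; case: (boolP (k %| j.+1)%N) => [k_dv|_]; last by rewrite mulr0 subr0.
by rewrite -[X in c ^+ (X %/ k)](subnK le_kj) divnDr // divnn k_gt0 addn1 exprS subrr.
Qed.

Lemma logder_qfactor c k : (0 < k)%N ->
  logder (1 - c *: psX ^+ k) (- k%:R *: (c *: (psX ^+ k * geom c k))).
Proof.
move=> k_gt0; rewrite /logder eulerD eulerN euler1 eulerZ eulerXn add0r.
rewrite -!scalerAl -mulrA [geom _ _ * _]mulrC geom_inv // mulr1 scaleNr.
by rewrite scalerA mulrC -scalerA.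
Qed.

(** Trades divisibility for a sum over cofactors [m+1], so that modes and cofactors share one index
    range and can be interchanged. *)
Lemma sum_dvd_delta (x : nat -> R) k n N : (0 < k)%N -> (N <= n)%N ->
  \sum_(m < n) (k * m.+1 == N)%N%:R * x m.+1 = if (0 < N)%N && (k %| N)%N then x (N %/ k)%N else 0.
Proof.
move=> k_gt0 le_Nn; case: (boolP (k %| N)%N) => [/dvdnP[[|q] NE]|Nk_dv].
- by rewrite NE big1 // => m _; rewrite muln_eq0 eqn0Ngt k_gt0 mul0r.
- have lt_qn : (q < n)%N by rewrite (leq_trans _ le_Nn) // NE leq_pmulr.
  rewrite NE mulnK // muln_gt0 k_gt0 /= (bigD1 (Ordinal lt_qn)) //= mulnC eqxx mul1r.
  rewrite big1 ?addr0 // => m; rewrite -val_eqE /= => /negPf ne_mq.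
  by rewrite mulnC eqn_pmul2r // eqSS ne_mq mul0r.
rewrite andbF big1 // => m _; case: eqP => [NE|]; last by rewrite mul0r.
by rewrite -NE dvdn_mulr in Nk_dv.
Qed.

Lemma coef_geom_shift c k n N : (0 < k)%N -> (N <= n)%N ->
  (c *: (psX ^+ k * geom c k)) N = \sum_(m < n) (k * m.+1 == N)%N%:R * c ^+ m.+1.
Proof.
move=> k_gt0 le_Nn; rewrite (sum_dvd_delta (fun m => c ^+ m)) // psZ psXnM /geom.
case: N {le_Nn} => [|N]; first by rewrite leqNgt k_gt0 /= mulr0.
have [le_kN|lt_Nk] := leqP k N.+1; last by rewrite gtnNdvd // mulr0.
rewrite dvdn_subl //=; case: ifP => [k_dv|]; last by rewrite mulr0.
by rewrite -[in RHS](subnK le_kN) divnDr // divnn k_gt0 addn1 exprS.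
Qed.

Lemma coef_euler_geom1 k n N : (0 < k)%N -> (N <= n)%N ->
  euler (geom 1 k) N = \sum_(m < n) (k * m.+1 == N)%N%:R * (k * m.+1)%:R.
Proof.
move=> k_gt0 le_Nn; rewrite (sum_dvd_delta (fun m => (k * m)%:R)) // eulerE /geom.
case: N {le_Nn} => [|N]; first by rewrite mul0r.
by case: ifP => [k_dv|]; rewrite ?mulr0 // expr1n mulr1 mulnC divnK.
Qed.

(** Absorption [n C(n-1,r) = (r+1) C(n,r+1)] at two levels, combined with Pascal's rule. *)
Lemma bin_laguerre m r :
  (m.+2 * 'C(m.+2, r.+1) + m.+1 * 'C(m, r.+1))%N
  = ((m.+1 + m.+2) * 'C(m.+1, r.+1) + r.+1 * 'C(m.+1, r))%N.
Proof.
have := mul_bin_diag m.+2 r; have := mul_bin_diag m.+1 r; rewrite /= (binS m.+1) (binS m).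
move: 'C(m, r) 'C(m, r.+1) 'C(m.+1, r) => a b d; nia.
Qed.

(** * Laguerre recurrence and the trace over one oscillator *)

Hypothesis char0 : [pchar R] =i pred0.

(** The recurrence [(n+1) L_(n+1) = (2n+1-x) L_n - n L_(n-1)] at [n = m+1], [x = -g], compared on
    [g^(r+1)/(r+1)!]. *)
Lemma mode_diag_laguerre g m :
  m.+2%:R * mode_diag g m.+2 + m.+1%:R * mode_diag g m =
  ((m.+1 + m.+2)%:R + g) * mode_diag g m.+1.
Proof.
have split0 k : (k <= m.+2)%N -> mode_diag g k =
    1 + \sum_(r < m.+2) g ^+ r.+1 / (r.+1)`!%:R * 'C(k, r.+1)%:R.
  by move/mode_diag_widen->; rewrite big_ord_recl expr0 fact0 bin0 divr1 mulr1.
have shift : g * mode_diag g m.+1 =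
    \sum_(r < m.+2) g ^+ r.+1 / (r.+1)`!%:R * (r.+1 * 'C(m.+1, r))%:R.
  rewrite big_distrr; apply: eq_bigr => r _ /=.
  rewrite exprS factS !natrM invfM; have := natf_neq0_pchar0 char0 r.
  move: _.+1%:R (g ^+ r) (_`!%:R^-1) 'C(_, _)%:R => x y z t x_neq0; by field.
rewrite [RHS]mulrDl shift (split0 m.+2) // (split0 m.+1) // (split0 m) ?leqW // !mulrDr !mulr1 addrACA -natrD addnC -addrA.
congr (_ + _); rewrite !big_distrr -!big_split; apply: eq_bigr => r _ /=.
rewrite !(mulrCA _%:R) -!mulrDr -!natrM -!natrD; congr (_ * _%:R).
exact: bin_laguerre.
Qed.

(** Trace over one oscillator with quanta of energy [k]: the state with [i] quanta sits at order
    [k i]. *)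
Definition mode_series g k : pser R :=
  fun j => if (k %| j)%N then mode_diag g (j %/ k) else 0.

Lemma mode_diag0 g : mode_diag g 0 = 1.
Proof. by rewrite /mode_diag big_ord1 expr0 fact0 bin0 divr1 mulr1. Qed.

Lemma mode_diag1 g : mode_diag g 1 = 1 + g.
Proof. by rewrite /mode_diag big_ord_recr big_ord1 /= expr0 fact0 bin0 !divr1 !mulr1. Qed.

(* Laguerre's recurrence as a first-order ODE for the generating function in u = v^k. *)
Lemma mode_series_ode g k : (0 < k)%N ->
  (1 - psX ^+ k) ^+ 2 * euler (mode_series g k) =
  k%:R *: ((g *: psX ^+ k + psX ^+ k * (1 - psX ^+ k)) * mode_series g k).
Proof.
move=> k_gt0; set F := mode_series g k; set X := psX ^+ k.
have -> : (1 - X) ^+ 2 * euler F = euler F - X * euler F *+ 2 + X * (X * euler F) by ring.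
have -> : (g *: X + X * (1 - X)) * F = g *: (X * F) + X * F - X * (X * F).
  by rewrite mulrDl -scalerAl; ring.
apply/funext => j; rewrite psZ !(psD, psN, psZ) mulr2n !psD !psXnM.
have [/dvdnP[q ->]|Nk_dv] := boolP (k %| j)%N; last first.
  have F0 i : ~~ (k %| i)%N -> F i = 0 by rewrite /F /mode_series => /negPf->.
  have Nk_dvB i : (k <= i)%N -> ~~ (k %| i)%N -> ~~ (k %| i - k)%N.
    by move=> le_ki; rewrite dvdn_subl.
  rewrite !eulerE F0 //; case: leqP => [le_kj|]; last by rewrite !(mulr0, oppr0, addr0).
  rewrite F0 ?Nk_dvB //; case: leqP => [le_kkj|]; last by rewrite !(mulr0, oppr0, addr0).
  by rewrite F0 ?Nk_dvB // !(mulr0, oppr0, addr0).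
have FE i : F (i * k)%N = mode_diag g i by rewrite /F /mode_series dvdn_mull // mulnK.
have shift i : (i.+1 * k - k = i * k)%N by rewrite mulSn addKn.
have le_k i : (k <= i.+1 * k)%N by rewrite leq_pmull.
(* Orders [0] and [k] follow from the initial values; from [2k] on Laguerre's recurrence applies. *)
rewrite !eulerE; case: q => [|[|q]].
- by rewrite leqNgt k_gt0 mul0n !mul0r !(mulr0, oppr0, addr0).
- by rewrite le_k shift !FE mul0n leqNgt k_gt0 mode_diag0 mode_diag1 /= mul1n; ring.
rewrite !le_k !shift !le_k !FE.
have := mode_diag_laguerre g q; rewrite !natrM.
move: (mode_diag g q.+2) (mode_diag g q.+1) (mode_diag g q) => x y z.
move: k%:R => u E.
transitivity (u * (q.+2%:R * x + q.+1%:R * z) - u * (q.+1%:R * y *+ 2 + z)); first by ring.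
by rewrite E natrD; ring.
Qed.

Lemma euler_geom1 k : (0 < k)%N ->
  euler (geom 1 k) = k%:R *: (psX ^+ k * geom 1 k ^+ 2).
Proof.
move=> k_gt0; set X := psX ^+ k; set G := geom 1 k.
have PG : (1 - X) * G = 1 by rewrite -[X]scale1r geom_inv.
have := congr1 (fun f => G * euler f) PG.
rewrite eulerM eulerD eulerN euler1 eulerXn -/X -/G mulr0 add0r => dPG.
transitivity ((1 - X) * G * euler G); first by rewrite PG mul1r.
apply/eqP; rewrite -subr_eq0 -dPG; apply/eqP.
by rewrite scalerAl; move: (k%:R *: X) => kX; ring.
Qed.

(** The factor [1 - v^k] cancels the term [X (1 - X)] of the differential equation. What is left
    belongs to [exp (g u/(1-u))], since [1/(1-u)] and [u/(1-u)] differ by a constant. *)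
Lemma logder_mode g k : (0 < k)%N ->
  logder ((1 - 1 *: psX ^+ k) * mode_series g k) (g *: euler (geom 1 k)).
Proof.
move=> k_gt0; rewrite /logder euler_geom1 // scale1r.
set X := psX ^+ k; set G := geom 1 k; set F := mode_series g k.
have PG : (1 - X) * G = 1 by rewrite -[X]scale1r geom_inv.
have dP : euler (1 - X) = - (k%:R *: X) by rewrite eulerD eulerN euler1 eulerXn add0r.
have PdPF : (1 - X) * euler ((1 - X) * F) = k%:R *: (g *: (X * F)).
  transitivity ((1 - X) ^+ 2 * euler F - (1 - X) * (k%:R *: X) * F).
    by rewrite eulerM dP; ring.
  rewrite mode_series_ode // -/X -/F mulrDl -scalerAl scalerDr -scalerAr -scalerAl.
  by rewrite [(1 - X) * X]mulrC addrK.
transitivity (G * ((1 - X) * euler ((1 - X) * F))); first by rewrite mulrA [G * _]mulrC PG mul1r.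
rewrite PdPF -!scalerAr -!scalerAl scalerA mulrC -scalerA; congr (_ *: (_ *: _)).
transitivity (((1 - X) * G) * (X * F * G)); first by rewrite PG mul1r mulrC.
by ring.
Qed.

End QSeries.

(** * Products over all modes and over the q-factors *)

Section Assembly.
Variables (R : fieldType).
Hypothesis char0 : [pchar R] =i pred0.

Lemma mode_series_eqn1 (g : R) k : ps_eqn k (mode_series g k.+1) 1.
Proof.
move=> [|i] le_ik; first by rewrite /mode_series dvdn0 div0n mode_diag0.
by rewrite /mode_series gtnNdvd.
Qed.

Lemma mode_series_expand (g : R) k n : (0 < k)%N ->
  ps_eqn n (mode_series g k) (\sum_(r < n.+1) mode_diag g r *: psX R ^+ (k * r)).
Proof.
move=> k_gt0 j le_jn; rewrite ps_sum /mode_series.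
case: (boolP (k %| j)%N) => [/dvdnP[q jE]|Nk_dv]; last first.
  rewrite big1 // => r _; rewrite psZ psXn; case: eqP => [jE|]; last by rewrite mulr0.
  by rewrite jE dvdn_mulr in Nk_dv.
have lt_qn : (q < n.+1)%N by rewrite ltnS (leq_trans _ le_jn) // jE leq_pmulr.
rewrite jE mulnK // (bigD1 (Ordinal lt_qn)) //= psZ psXn mulnC eqxx mulr1.
rewrite big1 ?addr0 // => r; rewrite -val_eqE /= => /negPf ne_rq.
by rewrite psZ psXn eqn_pmul2l // eq_sym ne_rq mulr0.
Qed.

(** Expanding the product, each choice of occupation numbers lands at the order given by its energy,
    so order [n] collects the basis of degree [n]. *)
Lemma trace_V0_degE (kappa q1 q2 t1 t2 : R) n :
  trace_V0_deg kappa q1 q2 t1 t2 n =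
  (\prod_(k < n) mode_series (mode_coupling kappa q1 q2 t1 t2 k.+1) k.+1) n.
Proof.
pose gam k := mode_coupling kappa q1 q2 t1 t2 k.+1.
transitivity (\sum_(m : 'X_{1..n < n.+1} | energy m == n)
                 \prod_(j < n) mode_diag (gam j) (m j)).
  by apply: eq_bigr => m /eqP em; rewrite V0_diag ?em.
rewrite (@sum_bmnm_ffun _ n n (fun m => energy m == n)
  (fun m => \prod_(j < n) mode_diag (gam j) (m j))); last first.
  by move=> m /eqP em; rewrite (leq_trans (leq_mdeg_energy m)) ?em.
rewrite (ps_eqn_prod _ (fun k : 'I_n => @mode_series_expand (gam k) k.+1 n isT)) //.
rewrite bigA_distr_bigA ps_sum big_mkcond; apply: eq_bigr => f _ /=.
rewrite scaler_prod psZ prodrXr psXn.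
have -> : \prod_(j < n) mode_diag (gam j) ([multinom (f i : nat) | i < n] j) =
          \prod_(j < n) mode_diag (gam j) (f j) by apply: eq_bigr => j _; rewrite mnmE.
have -> : energy [multinom (f i : nat) | i < n] = (\sum_(j < n) j.+1 * f j)%N.
  by apply: eq_bigr => j _; rewrite mnmE.
rewrite eq_sym.
by case: eqP => _; rewrite ?mulr1 ?mulr0.
Qed.

Lemma fock_char_eqn (kappa q1 q2 t1 t2 : R) n :
  ps_eqn n (fock_char kappa q1 q2 t1 t2)
   (\prod_(k < n) ((1 - 1 *: psX R ^+ k.+1) *
        mode_series (mode_coupling kappa q1 q2 t1 t2 k.+1) k.+1)).
Proof.
rewrite big_split /=; apply: ps_eqnM; first exact: qpoch_eqn.
move=> i le_in; rewrite trace_V0_degE.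
rewrite [RHS](ps_prod_stable
  (F := fun k => mode_series (mode_coupling kappa q1 q2 t1 t2 k.+1) k.+1)) // => k.
exact: mode_series_eqn1.
Qed.

Definition qprod (c : R) n : pser R := \prod_(k < n) (1 - c *: psX R ^+ k.+1).

Definition qprod_logder (c : R) n : pser R :=
  \sum_(k < n) (- k.+1%:R *: (c *: (psX R ^+ k.+1 * geom c k.+1))).

Lemma logder_qprod c n : logder (qprod c n) (qprod_logder c n).
Proof. by apply: logder_prod => k; apply: logder_qfactor. Qed.

Lemma qprod0 c n : qprod c n 0%N = 1.
Proof. by rewrite /qprod ps_prod0 big1 // => k _; rewrite (@qfactor_eqn1 R c k). Qed.

(** Here [k] gives the exponent of [c] and [m] the mode, to match the Fock side, where [k]-th powers
    come from the coupling of mode [k]. *)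
Lemma coef_qprod_logder c n N : (N <= n)%N ->
  qprod_logder c n N =
  - \sum_(k < n) \sum_(m < n) (k.+1 * m.+1 == N)%N%:R * (m.+1%:R * c ^+ k.+1).
Proof.
move=> le_Nn; rewrite /qprod_logder ps_sum [in RHS]exchange_big -sumrN; apply: eq_bigr => k _ /=.
rewrite psZ (@coef_geom_shift _ _ _ n) // mulNr big_distrr /=; congr (- _).
by apply: eq_bigr => m _; rewrite mulrCA mulnC.
Qed.

End Assembly.

Theorem theorem4p2 (R : fieldType) (hR : [pchar R] =i pred0)
    (kappa q1 q2 t1 t2 : R) (n : nat) :
  fock_char kappa q1 q2 t1 t2 n =
  ps_powk
    (ps_mul (ps_mul (qpoch (q1 * t1)) (qpoch (q2 * t2)))
            (ps_inv (ps_mul (qpoch (q1 * t2)) (qpoch (q2 * t1)))))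
    kappa n.
Proof.
(* Cutting every infinite product at [n] factors is exact up to order [n]. *)
pose num := qprod (q1 * t1) n * qprod (q2 * t2) n.
pose den := qprod (q1 * t2) n * qprod (q2 * t1) n.
have den0 : den 0%N = 1 by rewrite /den psM0 !qprod0 mulr1.
have quo0 : (num * ps_inv den) 0%N = 1 by rewrite /num !psM0 !qprod0 ps_inv0 // !mulr1.
have quo_logder := logderM (logderM (logder_qprod (q1 * t1) n) (logder_qprod (q2 * t2) n))
  (logderV den0 (logderM (logder_qprod (q1 * t2) n) (logder_qprod (q2 * t1) n))).
have log0 : ps_scale kappa (ps_log (num * ps_inv den)) 0%N = 0.
  by rewrite /ps_scale /ps_log big_ord0 coef0 mulr0.
have pow_logder := logder_exp hR log0.
rewrite (fock_char_eqn hR _ _ _ _ _ (leqnn n)).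
rewrite (@ps_powk_eqn _ n _ (num * ps_inv den) kappa) //; last first.
  apply: ps_eqnM; last apply: ps_inv_eqn.
    by apply: ps_eqnM; apply: qpoch_eqn.
  by apply: ps_eqnM; apply: qpoch_eqn.
have mode_logder (k : 'I_n) :=
  logder_mode hR (mode_coupling kappa q1 q2 t1 t2 k.+1) (ltn0Sn k).
(* There remain equality of constant terms, agreement of logarithmic derivatives up to order [n],
   and vanishing of the first one at order 0. *)
apply: (logder_inj_eqn hR _ (logder_prod _ mode_logder) pow_logder _ _ (leqnn n)).
- rewrite ps_prod0 ps_exp0 big1 // => k _.
  by rewrite psM0 (@qfactor_eqn1 _ 1 k) // (@mode_series_eqn1 _ _ k) // mulr1.
- move=> N le_Nn; rewrite eulerZ (euler_log hR quo0 quo_logder) psZ !(psD, psN).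
  rewrite !coef_qprod_logder // ps_sum -!sumrN -!big_split /=.
  rewrite -sumrN -!big_split big_distrr /=; apply: eq_bigr => k _.
  rewrite psZ (@coef_euler_geom1 _ k.+1 n) // -!sumrN -!big_split /= -sumrN -!big_split !big_distrr /=.
  (* Expanding [(q1^k - q2^k)(t2^k - t1^k)] gives the four powers with their signs, and the [1/k] of
     the coupling turns the weight [k m] into [m]; [k] and [m] stand for the successors of the
     indices. *)
  apply: eq_bigr => m _; rewrite /mode_coupling natrM !exprMn.
  have := natf_neq0_pchar0 hR k; move: (_ == N)%:R k.+1%:R => b x x_neq0.
  by field.
by rewrite ps_sum big1 // => k _; rewrite psZ euler0 mulr0.
Qed.
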